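(* Let $P$ be a natural unit interval order on $[n]$. Then $X_{\mathrm{inc}(P)}(\mathbf x,t)$ is a palindromic polynomial in $t$.
   Context: A natural unit interval order is a poset $P$ on $[n]$ such that (1) $x<_P y$ implies $x<y$ as integers, and (2) whenever the disjoint union of a chain $x<_P z$ and an element $y$ (incomparable to both) is an induced subposet of $P$, then $x<y<z$ as integers. $\mathrm{inc}(P)$ is the incomparability graph of $P$. For a graph $G$ on $[n]$, a proper coloring is $c:[n]\to\mathbb P$ with $c(i)\ne c(j)$ for $\{i,j\}\in E(G)$; $C(G)$ is the set of proper colorings, $\mathbf x_c=\prod_i x_{c(i)}$, $\mathrm{asc}(c)=|\{\{i,j\}\in E(G):i<j,\ c(i)<c(j)\}|$, and $X_G(\mathbf x,t)=\sum_{c\in C(G)}t^{\mathrm{asc}(c)}\mathbf x_c$. A polynomial $a_0+a_1t+\cdots+a_dt^d$ (here with coefficients symmetric functions, $a_d\neq 0$) is palindromic if $a_j=a_{d-j}$ for all $0\le j\le d$. *)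

(* Defs.v *)
From HB Require Import structures.
From mathcomp Require Import all_boot all_order all_algebra finmap.
From mathcomp Require Import mathcomp_extra boolp classical_sets functions.
From mathcomp Require Import cardinality fsbigop.
From mathcomp.multinomials Require Import monalg.

Set Implicit Arguments.
Unset Strict Implicit.
Unset Printing Implicit Defensive.

Import GRing.Theory.
Local Open Scope ring_scope.

(* The set [n] = {1, ..., n} is represented by 'I_n and the set of positive
   integers by nat, both through the order isomorphism k |-> k - 1. *)

Record simple_graph (n : nat) := SimpleGraph {
  adj :> rel 'I_n;
  adj_sym : symmetric adj;
  adj_irr : irreflexive adj
}.

Record poset (n : nat) := Poset {
  plt :> rel 'I_n;
  plt_irr : irreflexive plt;
  plt_trans : transitive plt
}.

Definition incomparable (n : nat) (P : poset n) : rel 'I_n :=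
  fun x y => [&& x != y, ~~ P x y & ~~ P y x].

Definition natural_unit_interval_order (n : nat) (P : poset n) : Prop :=
  (forall x y : 'I_n, P x y -> (x < y)%N) /\
  (forall x y z : 'I_n,
     P x z -> incomparable P y x -> incomparable P y z -> (x < y < z)%N).

Lemma incomparable_sym (n : nat) (P : poset n) : symmetric (incomparable P).
Proof. by move=> x y; rewrite /incomparable eq_sym; congr (_ && _); rewrite andbC. Qed.

Lemma incomparable_irr (n : nat) (P : poset n) : irreflexive (incomparable P).
Proof. by move=> x; rewrite /incomparable eqxx. Qed.

Definition inc (n : nat) (P : poset n) : simple_graph n :=
  SimpleGraph (@incomparable_sym n P) (@incomparable_irr n P).

Definition proper_coloring (n : nat) (G : simple_graph n)
    (c : {ffun 'I_n -> nat}) : Prop :=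
  forall i j : 'I_n, G i j -> c i != c j.

(* Each edge {i, j} is counted once, as the pair (i, j) with i < j. *)
Definition asc (n : nat) (G : simple_graph n) (c : {ffun 'I_n -> nat}) : nat :=
  #|[set p : 'I_n * 'I_n |
      [&& G p.1 p.2, (p.1 < p.2)%N & (c p.1 < c p.2)%N]]|.

Definition color_monomial (n : nat) (c : {ffun 'I_n -> nat}) : {cmonom nat} :=
  \big[mmul/mone]_(i < n) ucm (c i).

(* Formal power series in the variables x_0, x_1, ... with coefficients in R:
   a series is the function giving the coefficient of each monomial. *)
Definition power_series (R : Type) : Type := {cmonom nat} -> R.

(* X_G(x, t) as an element of Z[t][[x]]. The index set of the sum is finite, by
   [finite_color_monomial] below, so this is not the default value of an
   infinite finitely supported sum. *)
Definition chromatic_qsym (n : nat) (G : simple_graph n) :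
    power_series {poly int} :=
  fun m => \sum_(c \in [set c : {ffun 'I_n -> nat} |
                         proper_coloring G c /\ color_monomial c = m]%classic)
             ('X^(asc G c) : {poly int}).

Lemma color_monomialE (n : nat) (c : {ffun 'I_n -> nat}) (k : nat) :
  color_monomial c k = #|[set i | c i == k]|.
Proof.
rewrite /color_monomial -sum1dep_card [RHS]big_mkcond /=.
rewrite (big_morph (fun m : {cmonom nat} => m k) (cmM k)
           (cm1 k)).
by apply: eq_bigr => i _; rewrite cmU; case: eqP.
Qed.

Lemma finite_color_monomial (n : nat) (m : {cmonom nat}) :
  finite_set [set c : {ffun 'I_n -> nat} | color_monomial c = m]%classic.
Proof.
pose f (g : {ffun 'I_n -> finsupp m}) : {ffun 'I_n -> nat} :=
  [ffun i => val (g i)].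
apply: (@sub_finite_set _ _ (f @` setT)%classic); last first.
  exact/finite_image/finite_finset.
move=> c /= cm.
have cP i : c i \in finsupp m.
  rewrite mem_finsupp -cm color_monomialE -lt0n card_gt0.
  by apply/set0Pn; exists i; rewrite inE.
exists [ffun i => FSetSub (cP i)] => //.
by apply/ffunP => i; rewrite !ffunE.
Qed.

(* Symmetric functions over Z: series of bounded degree that are invariant
   under every permutation of the variables. *)
Definition symmetric_function (f : power_series int) : Prop :=
  (exists D : nat, forall m, f m != 0 -> (mdeg m <= D)%N) /\
  (forall (s : nat -> nat) (m m' : {cmonom nat}),
     bijective s -> (forall k, m' k = m (s k)) -> f m' = f m).

(* F = a_0 + a_1 t + ... + a_d t^d with each a_j a symmetric function,
   a_d nonzero, and a_j = a_(d - j). *)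
Definition palindromic (F : power_series {poly int}) : Prop :=
  exists (d : nat) (a : nat -> power_series int),
    [/\ forall m, F m = \poly_(j < d.+1) a j m,
        forall j, (j <= d)%N -> symmetric_function (a j),
        exists m, a d m != 0
      & forall j, (j <= d)%N -> a j =1 a (d - j)%N].

(* Main.v *)
From mathcomp Require Import all_boot all_order all_algebra finmap.
From mathcomp Require Import boolp classical_sets functions.
From mathcomp Require Import cardinality fsbigop.
From mathcomp.multinomials Require Import monalg.
From mathcomp Require Import zify.
Require Import Defs.

(* Let G = inc(P). If x < y < z and x, z are adjacent in G, then so are x, y and
   y, z. Hence in a proper coloring the vertices colored a or a + 1, listed in
   increasing order, are adjacent only when consecutive (else there would be a
   two-colored triangle), so they form increasing paths with alternating colors.
   Exchanging a and a + 1 on the paths with an odd number of vertices keeps the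
   number of ascents, since such a path has as many ascents as descents, and
   exchanges the multiplicities of a and a + 1, since even paths use both colors
   equally often. Thus X_G is symmetric. Reversing the order of the colors turns
   ascents into descents, so together with the symmetry the coefficients of t^j
   and of t^(|E| - j) agree; the coloring i |-> i has |E| ascents. *)

Set Implicit Arguments.
Unset Strict Implicit.
Unset Printing Implicit Defensive.

Import Order.TTheory GRing.Theory Num.Theory.
Local Open Scope nat_scope.

(** * Cutting a sequence into runs of related neighbours *)

Section Runs.

Variables (T : eqType) (e : rel T).

(** The pieces are the maximal blocks in which each element is related by [e] to the next. No piece
    is empty, so the last branch is met only when [s'] is empty. *)
Fixpoint runs (s : seq T) : seq (seq T) :=
  if s is x :: s' then
    if runs s' is (y :: r) :: rs then
      if e x y then (x :: y :: r) :: rs else [:: x] :: (y :: r) :: rs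
    else [:: [:: x]]
  else [::].

Lemma runs_cons x s : exists r rs, runs (x :: s) = (x :: r) :: rs.
Proof.
rewrite /=; case: (runs s) => [|[|y r] rs]; first by exists [::], [::].
  by exists [::], [::].
by case: ifP => _; [exists (y :: r), rs | exists [::], ((y :: r) :: rs)].
Qed.

Lemma flatten_runs s : flatten (runs s) = s.
Proof.
elim: s => // x [//|y s] IHs; have [r [rs Ers]] := runs_cons y s.
move: IHs; rewrite [runs (x :: y :: s)]/= -/(runs (y :: s)) Ers => IHs.
by case: ifP => _; case: IHs => /= ->.
Qed.

Lemma sorted_runs s : all (sorted e) (runs s).
Proof.
elim: s => // x [//|y s] IHs; have [r [rs Ers]] := runs_cons y s.
move: IHs; rewrite [runs (x :: y :: s)]/= -/(runs (y :: s)) Ers => IHs.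
by case: ifP => exy; move: IHs => /= /andP[-> ->]; rewrite ?exy.
Qed.

(** The runs of a duplicate-free sequence are disjoint, so [r] is the only run containing [x]. This
    evaluates the test in [swap_coloring]. *)
Lemma size_run_uniq s r x : uniq s -> r \in runs s -> x \in r ->
  has (fun r' => odd (size r') && (x \in r')) (runs s) = odd (size r).
Proof.
rewrite -{1}(flatten_runs s); elim: (runs s) => //= r0 rs IHrs.
rewrite cat_uniq => /and3P[_ /hasPn disj urs]; rewrite inE => /orP[/eqP-> | rrs].
  move=> xr; rewrite xr andbT; case: odd => //=; apply/hasPn => r' r'rs.
  rewrite negb_and; apply/orP; right; apply/negP => xr'.
  have /disj/negP : x \in flatten rs by apply/flattenP; exists r'.
  by apply.
move=> xr; rewrite (IHrs urs rrs xr).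
have /disj/negPf /= -> : x \in flatten rs by apply/flattenP; exists r.
by rewrite andbF.
Qed.

Definition edge_proper (d : T -> nat) : rel T :=
  fun x y => e x y ==> (d x != d y).

Fixpoint consecutive_asc (d : T -> nat) (s : seq T) : nat :=
  if s is x :: s' then
    (if s' is y :: _ then e x y && (d x < d y) : nat else 0)
      + consecutive_asc d s'
  else 0.

(** Where two runs meet, the neighbours are not related, so they impose no condition; for the same
    reason they contribute no ascent below. *)
Lemma sorted_edge_proper_runs d s :
  sorted (edge_proper d) s = all (sorted (edge_proper d)) (runs s).
Proof.
elim: s => // x [//|y s] IHs; have [r [rs Ers]] := runs_cons y s.
move: IHs; rewrite [runs (x :: y :: s)]/= -/(runs (y :: s)) Ers => IHs.
rewrite [LHS]/= -/(sorted (edge_proper d) (y :: s)) IHs {1}/edge_proper.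
by case: ifP => exy /=; rewrite /edge_proper ?exy -?andbA.
Qed.

Lemma consecutive_asc_runs d s :
  consecutive_asc d s = \sum_(r <- runs s) consecutive_asc d r.
Proof.
elim: s => [|x [|y s] IHs]; rewrite ?big_nil ?big_seq1 //.
have [r [rs Ers]] := runs_cons y s.
move: IHs; rewrite [runs (x :: y :: s)]/= -/(runs (y :: s)) Ers.
rewrite [consecutive_asc d (x :: y :: s)]/= -/(consecutive_asc d (y :: s)) => ->.
by case: ifP => exy; rewrite !big_cons /= ?exy ?addnA.
Qed.

Lemma eq_consecutive_asc d d' s :
  {in s, d =1 d'} -> consecutive_asc d s = consecutive_asc d' s.
Proof.
elim: s => // x s IHs dd'; rewrite /= IHs; last first.
  by move=> y ys; apply: dd'; rewrite inE ys orbT.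
case: s dd' {IHs} => // y s dd'; rewrite !dd' ?mem_head //.
by rewrite !inE eqxx orbT.
Qed.

Lemma eq_sorted_edge_proper d d' s : {in s, d =1 d'} ->
  sorted (edge_proper d) s = sorted (edge_proper d') s.
Proof.
move=> dd'; have eq_in : {in s &, edge_proper d =2 edge_proper d'}.
  by move=> x y xs ys; rewrite /edge_proper !dd'.
by apply: (eq_in_sorted eq_in); apply/allP.
Qed.

Section Alternating.

Variables (a : nat) (d : T -> nat).

(** The colors alternate, so of the two edges lost with the first two vertices exactly one is an
    ascent. The value does not depend on which color comes first, hence survives the exchange. *)
Lemma alternating_asc r :
    sorted e r -> sorted (edge_proper d) r ->
    all (fun x => d x \in [:: a; a.+1]) r -> odd (size r) ->
  consecutive_asc d r = (size r)./2.
Proof.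
have [m] := ubnP (size r); elim: m r => // m IHm [|x [|y [|z r]]] // lt_r_m.
move=> /= /and3P[exy eyz sr]; rewrite /edge_proper exy eyz /=.
move=> /and3P[dxy dyz pr] /and4P[dx dy dz dr]; rewrite negbK => odd_r.
have IH : consecutive_asc d (z :: r) = (size (z :: r))./2.
  by apply: IHm; rewrite //= ?dz //; move: lt_r_m => /=; lia.
move: IH => /= ->; move: dx dy dz dxy dyz; rewrite !inE; lia.
Qed.

(** The first two vertices carry one color each and can be removed together. *)
Lemma alternating_count r :
    sorted e r -> sorted (edge_proper d) r ->
    all (fun x => d x \in [:: a; a.+1]) r -> ~~ odd (size r) ->
  count (fun x => d x == a) r = count (fun x => d x == a.+1) r.
Proof.
have [m] := ubnP (size r); elim: m r => // m IHm [|x [|y r]] // lt_r_m.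
move=> /= /andP[exy sr]; rewrite /edge_proper exy /=.
move=> /andP[dxy pr] /and3P[dx dy dr]; rewrite negbK => odd_r.
have -> := IHm r; rewrite ?dr //=.
- by move: dx dy dxy; rewrite !inE; lia.
- by move: lt_r_m => /=; lia.
- exact: path_sorted sr.
- exact: path_sorted pr.
Qed.

End Alternating.

End Runs.

(** * Exchanging two consecutive colors on one run *)

Definition swap_colors (a k : nat) : nat :=
  if k == a then a.+1 else if k == a.+1 then a else k.

Lemma swap_colorsK a : involutive (swap_colors a).
Proof. by move=> k; rewrite /swap_colors; do ![case: ifP]; lia. Qed.

Lemma swap_colors_in a k : (swap_colors a k \in [:: a; a.+1]) = (k \in [:: a; a.+1]).
Proof. by rewrite !inE /swap_colors; do ![case: ifP]; lia. Qed.

Lemma swap_colors_out a k : k \notin [:: a; a.+1] -> swap_colors a k = k.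
Proof. by rewrite !inE /swap_colors; do ![case: ifP]; lia. Qed.

Section SwapRun.

Variables (T : eqType) (e : rel T) (a : nat) (c d : T -> nat) (r : seq T).
Hypotheses (sr : sorted e r) (pr : sorted (edge_proper e c) r).
Hypothesis cr : all (fun x => c x \in [:: a; a.+1]) r.
Hypothesis dE :
  {in r, d =1 fun x => if odd (size r) then swap_colors a (c x) else c x}.

Lemma swap_run_proper : sorted (edge_proper e d) r.
Proof.
rewrite (eq_sorted_edge_proper e dE); case: (odd _) => //.
rewrite -(@eq_sorted _ (edge_proper e c)) // => x y.
by rewrite /edge_proper (inj_eq (inv_inj (swap_colorsK a))).
Qed.

Lemma swap_run_asc : consecutive_asc e d r = consecutive_asc e c r.
Proof.
case: (boolP (odd (size r))) => odd_r; last first.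
  by apply: eq_consecutive_asc => x xr; rewrite dE // (negPf odd_r).
rewrite (alternating_asc sr pr cr) //.
apply: (alternating_asc (a := a) sr swap_run_proper) => //.
apply/allP => x xr; rewrite dE // odd_r swap_colors_in; exact: (allP cr).
Qed.

(** An odd run is relabelled throughout. An even run is unchanged, but [a] and [a.+1] occur equally
    often in it. *)
Lemma swap_run_count k :
  count (fun x => d x == k) r = count (fun x => c x == swap_colors a k) r.
Proof.
rewrite (@eq_in_count _ _ (fun x => (if odd (size r) then swap_colors a (c x) else c x) == k));
  last by move=> x xr /=; rewrite dE.
case: (boolP (odd (size r))) => odd_r.
  by apply: eq_count => x /=; rewrite -(inj_eq (inv_inj (swap_colorsK a))) swap_colorsK.
have alt := alternating_count sr pr cr odd_r; rewrite /swap_colors.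
by case: eqP => [->//|_]; case: eqP => [->|].
Qed.

End SwapRun.

(** * Increasing sequences in which only neighbours can be adjacent *)

Section SparseSequence.

Variables (n : nat) (e : rel 'I_n) (d : 'I_n -> nat) (s : seq 'I_n).

Hypothesis s_incr : pairwise (fun x y : 'I_n => x < y) s.
Hypothesis s_sparse : forall x y z, x \in s -> y \in s -> z \in s ->
  x < y -> y < z -> ~~ e x z.

(** Two elements that are not consecutive in [s] have another one between them, so [s_sparse]
    excludes an edge; consecutive ones are covered by sortedness. *)
Lemma sparse_edge_proper : sorted (edge_proper e d) s ->
  {in s &, forall x y : 'I_n, x < y -> e x y -> d x != d y}.
Proof.
elim: s s_incr s_sparse => // x0 s' IHs /= /andP[/allP lt_x0 s'_incr] sparse.
move=> ps' x y; rewrite !inE => /orP[/eqP-> | xs'] /orP[/eqP-> | ys'].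
- by rewrite ltnn.
- case: s' {IHs} lt_x0 s'_incr sparse ps' ys' => // y0 s' lt_x0 s'_incr sparse ps'.
  rewrite inE => /orP[/eqP-> _ ex0y | ys' _].
    by move: ps' => /= /andP[+ _]; rewrite /edge_proper ex0y.
  apply: contraTT => _; apply: (sparse _ y0).
  + exact: mem_head.
  + by rewrite !inE eqxx orbT.
  + by rewrite !inE ys' !orbT.
  + exact/lt_x0/mem_head.
  + by move: s'_incr => /= /andP[/allP lt_y0 _]; apply: lt_y0.
- by rewrite ltnNge ltnW // lt_x0.
- apply: IHs => //; last exact: path_sorted ps'.
  by move=> u v w us vs ws; apply: sparse; rewrite inE ?us ?vs ?ws orbT.
Qed.

Lemma sum_sparse_edges :
  \sum_(x <- s) \sum_(y <- s) [&& e x y, x < y & d x < d y]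
    = consecutive_asc e d s.
Proof.
elim: s s_incr s_sparse => [|x0 s' IHs]; first by rewrite big_nil.
move=> /= /andP[/allP lt_x0 s'_incr] sparse.
rewrite big_cons big_cons ltnn andbF add0n; congr (_ + _).
  case: s' {IHs} lt_x0 s'_incr sparse => [|y0 s'] lt_x0 s'_incr sparse.
    by rewrite big_nil.
  rewrite big_cons lt_x0 ?mem_head // big1_seq ?addn0 // => y /= ys'.
  suff /negPf-> : ~~ e x0 y by [].
  apply: (sparse _ y0).
  + exact: mem_head.
  + by rewrite !inE eqxx orbT.
  + by rewrite !inE ys' !orbT.
  + exact/lt_x0/mem_head.
  + by move: s'_incr => /= /andP[/allP lt_y0 _]; apply: lt_y0.
rewrite -IHs //; last first.
  by move=> u v w us vs ws; apply: sparse; rewrite inE ?us ?vs ?ws orbT.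
apply: eq_big_seq => x xs'; rewrite big_cons.
by rewrite [x < x0]ltnNge ltnW ?lt_x0 // andbF.
Qed.

End SparseSequence.

(** * Ascents inside and outside a vertex set *)

Section Ascents.

Variables (n : nat) (G : simple_graph n).
Implicit Type c : {ffun 'I_n -> nat}.

Lemma asc_sum c :
  asc G c = \sum_x \sum_y [&& G x y, x < y & c x < c y].
Proof.
by rewrite /asc -sum1dep_card big_mkcond pair_big; apply: eq_bigr => p _; case: ifP.
Qed.

(** With [V] the vertices colored [a] or [a.+1], the first sum will be compared run by run and the
    second term by term. *)
Lemma asc_split c (V : {pred 'I_n}) :
  asc G c = \sum_(x in V) \sum_(y in V) [&& G x y, x < y & c x < c y]
    + \sum_x \sum_(y | ~~ ((x \in V) && (y \in V))) [&& G x y, x < y & c x < c y].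
Proof.
rewrite asc_sum [X in _ = X + _]big_mkcond -big_split; apply: eq_bigr => x _ /=.
rewrite (bigID (fun y => (x \in V) && (y \in V))) /=; congr (_ + _).
by case: (x \in V) => //=; rewrite big_pred0_eq.
Qed.

End Ascents.

(** * The color exchange as an involution on proper colorings *)

Section SwapColoring.

Variables (n : nat) (G : simple_graph n).

Hypothesis G_interval :
  forall x y z : 'I_n, x < y -> y < z -> G x z -> G x y && G y z.

Variable a : nat.

Definition two_colored (c : {ffun 'I_n -> nat}) : seq 'I_n :=
  [seq x <- enum 'I_n | c x \in [:: a; a.+1]].

(* The involution of Shareshian and Wachs: each run is a connected component,
   in fact an increasing path, of the subgraph colored by [a] and [a.+1]. *)
Definition swap_coloring (c : {ffun 'I_n -> nat}) : {ffun 'I_n -> nat} :=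
  [ffun x => if has (fun r => odd (size r) && (x \in r)) (runs G (two_colored c))
             then swap_colors a (c x) else c x].

Lemma mem_two_colored (c : {ffun 'I_n -> nat}) x : (x \in two_colored c) = (c x \in [:: a; a.+1]).
Proof. by rewrite mem_filter mem_enum andbT. Qed.

Lemma uniq_two_colored c : uniq (two_colored c).
Proof. exact/filter_uniq/enum_uniq. Qed.

Lemma sorted_two_colored c : pairwise (fun x y : 'I_n => x < y) (two_colored c).
Proof.
apply: pairwise_filter; rewrite -(pairwise_map val ltn) val_enum_ord.
by rewrite -sorted_pairwise ?iota_ltn_sorted //; exact: ltn_trans.
Qed.

Lemma swap_coloring_out (c : {ffun 'I_n -> nat}) x :
  c x \notin [:: a; a.+1] -> swap_coloring c x = c x.
Proof. by move=> cx; rewrite ffunE swap_colors_out // if_same. Qed.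

Lemma swap_coloring_in (c : {ffun 'I_n -> nat}) x :
  (swap_coloring c x \in [:: a; a.+1]) = (c x \in [:: a; a.+1]).
Proof. by rewrite ffunE; case: ifP => // _; rewrite swap_colors_in. Qed.

(** The swap keeps the set of vertices colored [a] or [a.+1], hence the runs, so the second
    application acts on the same vertices. *)
Lemma swap_coloringK : involutive swap_coloring.
Proof.
move=> c; apply/ffunP => x; rewrite ffunE.
have -> : two_colored (swap_coloring c) = two_colored c.
  by apply: eq_filter => y; rewrite swap_coloring_in.
by rewrite ffunE; case: ifP => odd_x; rewrite odd_x ?swap_colorsK.
Qed.

Lemma swap_coloring_run (c : {ffun 'I_n -> nat}) r : r \in runs G (two_colored c) ->
  {in r, swap_coloring c =1
         fun x => if odd (size r) then swap_colors a (c x) else c x}.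
Proof.
by move=> rc x xr; rewrite ffunE (size_run_uniq (uniq_two_colored c) rc xr).
Qed.

Lemma run_two_colored (c : {ffun 'I_n -> nat}) r : r \in runs G (two_colored c) ->
  all (fun x => c x \in [:: a; a.+1]) r.
Proof.
move=> rc; apply/allP => x xr; rewrite -mem_two_colored -(flatten_runs G (two_colored c)).
by apply/flattenP; exists r.
Qed.

Section Proper.

Variable c : {ffun 'I_n -> nat}.
Hypothesis c_proper : proper_coloring G c.

(* Otherwise [x], [y], [z] would be a two-colored triangle. *)
Lemma two_colored_nonadj x y z :
    x \in two_colored c -> y \in two_colored c -> z \in two_colored c ->
  x < y -> y < z -> ~~ G x z.
Proof.
rewrite !mem_two_colored !inE => cx cy cz xy yz; apply/negP => Gxz.
have /andP[Gxy Gyz] := G_interval xy yz Gxz.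
move: (c_proper Gxy) (c_proper Gyz) (c_proper Gxz); lia.
Qed.

Lemma sorted_run r : r \in runs G (two_colored c) -> sorted G r.
Proof. exact/allP/sorted_runs. Qed.

Lemma two_colored_proper : sorted (edge_proper G c) (two_colored c).
Proof.
apply: sub_sorted (pairwise_sorted (sorted_two_colored c)) => x y _.
exact/implyP/c_proper.
Qed.

Lemma proper_run r :
  r \in runs G (two_colored c) -> sorted (edge_proper G c) r.
Proof. by move: r; apply/allP; rewrite -sorted_edge_proper_runs two_colored_proper. Qed.

Lemma swap_coloring_proper : proper_coloring G (swap_coloring c).
Proof.
suff lt_proper (x y : 'I_n) : x < y -> G x y -> swap_coloring c x != swap_coloring c y.
  move=> x y Gxy; have := Gxy; case: (ltngtP x y) => [xy|yx|/val_inj->].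
  - exact: lt_proper.
  - by rewrite eq_sym adj_sym; apply: lt_proper.
  - by rewrite adj_irr.
(* If an end has a color other than [a] and [a.+1], the colors stay distinct because the swap
   preserves membership in this pair. Edges with both ends inside are handled through the runs. *)
move=> xy Gxy; case: (boolP (c x \in [:: a; a.+1])) => cx; last first.
  rewrite swap_coloring_out //; case: (boolP (c y \in [:: a; a.+1])) => cy.
    by apply: contraNneq cx => ->; rewrite swap_coloring_in.
  by rewrite swap_coloring_out ?c_proper.
case: (boolP (c y \in [:: a; a.+1])) => cy; last first.
  rewrite (swap_coloring_out cy); apply: contraNneq cy => <-.
  by rewrite swap_coloring_in.
apply: (sparse_edge_proper (sorted_two_colored c) two_colored_nonadj) xy Gxy;
  rewrite ?mem_two_colored //.
rewrite sorted_edge_proper_runs; apply/allP => r rc.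
exact: swap_run_proper (proper_run rc) (swap_coloring_run rc).
Qed.

Lemma swap_coloring_asc : asc G (swap_coloring c) = asc G c.
Proof.
rewrite !(asc_split _ _ (mem (two_colored c))); congr (_ + _).
  rewrite -!big_uniq ?uniq_two_colored //=.
  under eq_bigr do rewrite -big_uniq ?uniq_two_colored //=.
  under [RHS]eq_bigr do rewrite -big_uniq ?uniq_two_colored //=.
  rewrite !(sum_sparse_edges _ (sorted_two_colored c) two_colored_nonadj).
  rewrite !consecutive_asc_runs; apply: eq_big_seq => r rc.
  apply: swap_run_asc (swap_coloring_run rc) => //.
  - exact: sorted_run.
  - exact: proper_run.
  - exact: run_two_colored.
(* At least one of the two colors is neither [a] nor [a.+1]. As no color lies strictly between
   these, the exchange does not affect the comparison. *)
apply: eq_bigr => x _; apply: eq_bigr => y; rewrite !mem_two_colored.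
rewrite !ffunE; set bx := has _ _; set b_y := has _ _.
rewrite /swap_colors !inE => xy; congr (nat_of_bool [&& _, _ & _]).
by move: xy; do ![case: ifP]; lia.
Qed.

Lemma swap_coloring_content k :
  #|[set i | swap_coloring c i == k]| = #|[set i | c i == swap_colors a k]|.
Proof.
(* Both colorings are counted over the same partition of the vertices, the one given by [c]. *)
have card_count (d : {ffun 'I_n -> nat}) j :
    #|[set i | d i == j]| = count (fun i => d i == j) (two_colored c)
      + count (fun i => d i == j) [seq i <- enum 'I_n | c i \notin [:: a; a.+1]].
  rewrite cardsE cardE {1}/enum_mem size_filter -enumT -count_cat.
  have /seq.permP/(_ (fun i => d i == j)) E :=
    permEl (perm_filterC (fun i => c i \in [:: a; a.+1]) (enum 'I_n)).
  by apply: etrans (esym E); apply: eq_count.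
rewrite !card_count; congr (_ + _); last first.
  apply: eq_in_count => x; rewrite mem_filter => /andP[cx _] /=.
  rewrite swap_coloring_out //; move: cx; rewrite !inE /swap_colors.
  by do ![case: ifP]; lia.
rewrite -{1 2}(flatten_runs G (two_colored c)) !count_flatten; congr sumn.
apply/eq_in_map => r rc; apply: swap_run_count (swap_coloring_run rc) _.
- exact: sorted_run.
- exact: proper_run.
- exact: run_two_colored.
Qed.

End Proper.

End SwapColoring.

(** * From adjacent exchanges to all permutations of the variables *)

(** Adjacent exchanges carry the head of [s] to the front of [s']; the prefix [p] collects the
    elements already matched. *)
Lemma adjacent_swap_perm (T : eqType) (U : Type) (F : seq T -> U) :
    (forall s1 x y s2, F (s1 ++ x :: y :: s2) = F (s1 ++ y :: x :: s2)) ->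
  forall s s', perm_eq s s' -> F s = F s'.
Proof.
move=> swapF s s'.
have to_front p t1 x t2 : F (p ++ t1 ++ x :: t2) = F (p ++ x :: t1 ++ t2).
  elim: t1 p => // y t1 IHt p.
  by rewrite /= -cat_rcons IHt cat_rcons swapF.
suff gen p : perm_eq s s' -> F (p ++ s) = F (p ++ s') by exact: (gen [::]).
elim: s p s' => [|x s IHs] p s'.
  by move=> /perm_size/esym/size0nil->.
move=> /[dup] /perm_mem/(_ x); rewrite mem_head => /esym/splitPr[t1 t2].
rewrite -[x :: t2]/([:: x] ++ t2) perm_sym perm_catCA /= perm_cons perm_sym.
by move=> /IHs eqF; rewrite to_front -!cat_rcons.
Qed.

Lemma perm_filter_neq0 (s s' : seq nat) : size s = size s' ->
    perm_eq [seq k <- s | k != 0] [seq k <- s' | k != 0] -> perm_eq s s'.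
Proof.
have zeros t : [seq k <- t | predC (fun k => k != 0) k]
    = nseq (size t - size [seq k <- t | k != 0]) 0.
  elim: t => // -[|k] t IHt /=; rewrite IHt ?subSS //.
  by rewrite subSn // size_filter count_size.
move=> eq_size eq_perm.
rewrite -(perm_filterC (fun k => k != 0) s) perm_sym.
rewrite -(perm_filterC (fun k => k != 0) s') perm_sym !zeros.
by rewrite eq_size (perm_size eq_perm) perm_cat2r.
Qed.

(** The indices below [N] need not be stable under [s], but [s] maps the support of [m'] bijectively
    onto that of [m]; the remaining entries are zeros, equally many on both sides. *)
Lemma perm_mkseq_bij (m m' s : nat -> nat) N :
    bijective s -> (forall k, m' k = m (s k)) ->
    (forall k, N <= k -> m k = 0) -> (forall k, N <= k -> m' k = 0) ->
  perm_eq (mkseq m' N) (mkseq m N).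
Proof.
move=> [s' sK s'K] m'E m0 m'0; apply: perm_filter_neq0.
  by rewrite !size_mkseq.
rewrite /mkseq !filter_map (eq_map m'E) (map_comp m s); apply: perm_map.
apply: uniq_perm.
- by rewrite map_inj_uniq ?filter_uniq ?iota_uniq //; apply: can_inj sK.
- by rewrite filter_uniq ?iota_uniq.
move=> k; rewrite mem_filter mem_iota /= add0n.
apply/mapP/andP => [[j] | [mk0 ltk]].
  rewrite mem_filter /= m'E => /andP[mj0 _] ->; split=> //.
  by rewrite ltnNge; apply: contraNN mj0 => /m0->.
exists (s' k); last by rewrite s'K.
rewrite mem_filter /= mem_iota m'E s'K mk0 add0n ltnNge /=.
by apply: contraNN mk0 => /m'0; rewrite m'E s'K => ->.
Qed.

Lemma nth_mkseq_bounded (m : nat -> nat) N :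
  (forall k, N <= k -> m k = 0) -> nth 0 (mkseq m N) =1 m.
Proof.
move=> m0 k; case: (ltnP k N) => [ltk | lek]; first by rewrite nth_mkseq.
by rewrite nth_default ?size_mkseq // m0.
Qed.

Lemma cmonom_bounded (m : {cmonom nat}) : exists N, forall k, N <= k -> m k = 0.
Proof.
exists (\max_(i <- finsupp m) i).+1 => k ltk; apply/eqP; apply: contraTT ltk.
by rewrite -mem_finsupp -ltnNge ltnS => km; apply: leq_bigmax_seq.
Qed.

Local Open Scope ring_scope.

Lemma reindex_fsbig_involution (T : choiceType) (V : nmodType) (A B : set T)
    (h : T -> T) (F : T -> V) :
    (forall x, A x -> B (h x)) -> (forall x, B x -> A (h x)) ->
    (forall x, A x -> h (h x) = x) -> (forall x, B x -> h (h x) = x) ->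
  \sum_(x \in B) F x = \sum_(x \in A) F (h x).
Proof.
move=> hAB hBA hKA hKB; apply: reindex_fsbig; split=> //.
- move=> x y; rewrite !inE => Ax Ay eq_h.
  by rewrite -(hKA x Ax) eq_h hKA.
- by move=> x Bx; exists (h x); [apply: hBA | apply: hKB].
Qed.

(** * Colorings with given color multiplicities; reversal of the colors *)

Section ChromaticContent.

Variables (n : nat) (G : simple_graph n).
Implicit Type c : {ffun 'I_n -> nat}.

(** Contents are arbitrary functions rather than monomials, so that [nth 0 s] and compositions with
    [swap_colors a] can be used directly. *)
Definition colorings_with_content (m : nat -> nat) : set {ffun 'I_n -> nat} :=
  [set c | proper_coloring G c /\
           forall k, #|[set i | c i == k]%SET| = m k]%classic.

Definition chromatic_content (m : nat -> nat) : {poly int} :=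
  \sum_(c \in colorings_with_content m) ('X^(asc G c) : {poly int}).

Lemma chromatic_qsymE m : chromatic_qsym G m = chromatic_content m.
Proof.
rewrite /chromatic_qsym /chromatic_content.
suff -> : [set c | proper_coloring G c /\ color_monomial c = m]%classic
    = colorings_with_content m by [].
apply/seteqP; split=> c [c_proper cm]; split=> //.
  by move=> k; rewrite -color_monomialE cm.
by apply/eqP/cmP => k; rewrite color_monomialE cm.
Qed.

Lemma eq_chromatic_content (m m' : nat -> nat) :
  m =1 m' -> chromatic_content m = chromatic_content m'.
Proof. by move=> /funext->. Qed.

(** Either the set is empty, as for [m] of infinite support, or all its members share the monomial
    of one of them. *)
Lemma finite_colorings m : finite_set (colorings_with_content m).
Proof.
have [[c0 [_ c0m]] | no_c] := pselect (exists c, colorings_with_content m c).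
  apply: sub_finite_set (@finite_color_monomial n (color_monomial c0)) => c [_ cm].
  by apply/eqP/cmP => k; rewrite !color_monomialE c0m cm.
suff -> : colorings_with_content m = set0 by exact: finite_set0.
by rewrite -subset0 => c cm; apply: no_c; exists c.
Qed.

Lemma coef_chromatic_content m j :
  (chromatic_content m)`_j
    = \sum_(c <- fset_set (colorings_with_content m)) (j == asc G c)%:R.
Proof.
rewrite /chromatic_content fsbig_finite; last exact: finite_colorings.
by rewrite coef_sum; apply: eq_bigr => c _; rewrite coefXn.
Qed.

Definition edges : {set 'I_n * 'I_n} :=
  [set p : 'I_n * 'I_n | G p.1 p.2 & (p.1 < p.2)%N].

Lemma asc_le_edges c : (asc G c <= #|edges|)%N.
Proof. by apply/subset_leq_card/fintype.subsetP => p; rewrite !inE => /and3P[-> ->]. Qed.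

Section Reversal.

Variable N : nat.

(** Because the subtraction is truncated, this is an involution only on colors below [N]. *)
Definition reverse_coloring c : {ffun 'I_n -> nat} :=
  [ffun i => (N - (c i).+1)%N].

Lemma reverse_coloringK c : (forall i, c i < N)%N ->
  reverse_coloring (reverse_coloring c) = c.
Proof.
by move=> ltcN; apply/ffunP => i; rewrite !ffunE; move: (c i) (ltcN i) => k; lia.
Qed.

(** In a proper coloring every edge is an ascent or a descent, and the reflection turns one into the
    other. *)
Lemma asc_reverse_coloring c : proper_coloring G c -> (forall i, c i < N)%N ->
  asc G (reverse_coloring c) = (#|edges| - asc G c)%N.
Proof.
move=> c_proper ltcN; rewrite -(cardsID [set p | (c p.1 < c p.2)%N] edges).
have -> : asc G c = #|edges :&: [set p | (c p.1 < c p.2)%N]|.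
  by apply: eq_card => p; rewrite !inE andbA.
rewrite addKn; apply: eq_card => p; rewrite !inE !ffunE.
case: (boolP (G p.1 p.2)) => [Gp|]; rewrite ?andbF //=.
by move: (c p.1) (c p.2) (c_proper _ _ Gp) (ltcN p.1) (ltcN p.2) => u v; lia.
Qed.

End Reversal.

(** The default value 0 of [nth] forbids all colors from [size s] on. *)
Lemma content_lt (s : seq nat) c : colorings_with_content (nth 0%N s) c ->
  forall i, (c i < size s)%N.
Proof.
move=> [_ cs] i; rewrite ltnNge; apply/negP => le_s.
have := cs (c i); rewrite nth_default // => /eqP; rewrite cards_eq0 => /eqP/setP/(_ i).
by rewrite !inE eqxx.
Qed.

Lemma reverse_coloring_content (s : seq nat) c :
    colorings_with_content (nth 0%N s) c ->
  colorings_with_content (nth 0%N (rev s)) (reverse_coloring (size s) c).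
Proof.
move=> cs; have ltcs := content_lt cs; case: cs => c_proper cs; split.
  move=> i j Gij; rewrite !ffunE.
  by move: (c i) (c j) (c_proper _ _ Gij) (ltcs i) (ltcs j) => u v; lia.
move=> k; case: (ltnP k (size s)) => [ltk | lek].
  rewrite nth_rev // -cs; apply: eq_card => i; rewrite !inE !ffunE.
  by move: (c i) (ltcs i) => u; lia.
rewrite nth_default ?size_rev //; apply/eqP; rewrite cards_eq0; apply/eqP/setP => i.
by rewrite !inE ffunE; move: (c i) (ltcs i) => u; lia.
Qed.

Lemma coef_chromatic_content_rev (s : seq nat) j : (j <= #|edges|)%N ->
  (chromatic_content (nth 0%N (rev s)))`_j
    = (chromatic_content (nth 0%N s))`_(#|edges| - j).
Proof.
move=> le_j; have E : chromatic_content (nth 0%N (rev s)) =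
    \sum_(c \in colorings_with_content (nth 0%N s))
       ('X^(asc G (reverse_coloring (size s) c)) : {poly int}).
  apply: reindex_fsbig_involution.
  - exact: reverse_coloring_content.
  - by move=> c cs; rewrite -{1}(revK s) -(size_rev s); apply: reverse_coloring_content.
  - by move=> c cs; apply/reverse_coloringK/content_lt.
  - move=> c cs; apply/reverse_coloringK; rewrite -(size_rev s); exact: content_lt.
rewrite E coef_chromatic_content fsbig_finite; last exact: finite_colorings.
rewrite coef_sum; apply: eq_big_seq => c.
rewrite in_fset_set; last exact: finite_colorings.
rewrite inE => cs; rewrite coefXn asc_reverse_coloring; first last.
- exact: content_lt.
- by case: cs.
(* Both [j] and [asc G c] are at most the number of edges, so truncation does no harm. *)
congr (_ %:R); move: (asc G c) #|edges| (asc_le_edges c) le_j => u v; lia.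
Qed.

End ChromaticContent.

(** * The interval property of incomparability graphs *)

(** If [P x y], then [z] is incomparable to [x], and to [y] since [P y z] would give [P x z]; the
    unit interval condition then puts [z] between [x] and [y], against [y < z]. The case [P y z] is
    dual. *)
Lemma inc_interval n (P : poset n) : natural_unit_interval_order P ->
  forall x y z : 'I_n, (x < y)%N -> (y < z)%N -> inc P x z -> inc P x y && inc P y z.
Proof.
move=> [P_lt P_unit] x y z xy yz /and3P[xz nPxz nPzx].
have not_gt (u v : 'I_n) : (u < v)%N -> ~~ P v u.
  by move=> uv; apply/negP => /P_lt; lia.
have neq (u v : 'I_n) : (u < v)%N -> u != v.
  by move=> uv; rewrite -val_eqE /= neq_ltn uv.
have P_trans u v w : P u v -> P v w -> P u w by move=> uv vw; apply: plt_trans uv vw.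
have inc_sym u v : incomparable P u v -> incomparable P v u.
  by rewrite incomparable_sym.
have inc_xz : incomparable P x z by apply/and3P.
apply/andP; split; apply/and3P; split;
  try exact: neq; try exact: not_gt; apply/negP.
  move=> Pxy; suff : incomparable P z y by move=> /(P_unit _ _ _ Pxy (inc_sym _ _ inc_xz)); lia.
  apply: inc_sym; apply/and3P; split; [exact: neq | | exact: not_gt].
  by apply: contraNN nPxz; apply: P_trans.
move=> Pyz; suff : incomparable P x y by move=> /(P_unit _ _ _ Pyz)/(_ inc_xz); lia.
apply/and3P; split; [exact: neq | | exact: not_gt].
by apply: contraNN nPxz => Pxy; apply: P_trans Pyz.
Qed.

(** * Symmetry in the variables and of the coefficients in [t] *)

Section Symmetry.

Variables (n : nat) (P : poset n).
Hypothesis P_nuio : natural_unit_interval_order P.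

Let G_interval := inc_interval P_nuio.

Lemma chromatic_content_swap (a : nat) (m : nat -> nat) :
  chromatic_content (inc P) (fun k => m (swap_colors a k))
    = chromatic_content (inc P) m.
Proof.
rewrite {1}/chromatic_content.
rewrite (@reindex_fsbig_involution _ _ (colorings_with_content (inc P) m) _
           (swap_coloring (inc P) a)).
- apply: eq_fsbigr => c; rewrite inE => -[c_proper _].
  by rewrite swap_coloring_asc.
- move=> c [c_proper cm]; split; first exact: swap_coloring_proper.
  by move=> k; rewrite swap_coloring_content.
- move=> c [c_proper cm]; split; first exact: swap_coloring_proper.
  by move=> k; rewrite swap_coloring_content // cm swap_colorsK.
- by move=> c _; apply: swap_coloringK.
- by move=> c _; apply: swap_coloringK.
Qed.

Lemma chromatic_content_perm (s s' : seq nat) : perm_eq s s' ->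
  chromatic_content (inc P) (nth 0%N s) = chromatic_content (inc P) (nth 0%N s').
Proof.
apply: (adjacent_swap_perm (F := fun s => chromatic_content (inc P) (nth 0%N s))).
(* [x] and [y] stand at the positions [size s1] and [(size s1).+1], which this swap exchanges. *)
move=> s1 x y s2; rewrite -(chromatic_content_swap (size s1)).
apply: eq_chromatic_content => k; rewrite /swap_colors !nth_cat.
case: eqVneq => [->|k_neq]; first by rewrite ltnn subnn ltnNge leqnSn subSnn.
case: eqVneq => [->|k_neq1]; first by rewrite ltnn subnn ltnNge leqnSn subSnn.
case: ltnP => // le_k; set p := size s1 in k_neq k_neq1 le_k *.
(* Here [k] lies beyond both exchanged entries. *)
by have -> : (k - p = (k - p - 2).+2)%N by lia.
Qed.

Lemma chromatic_qsym_symmetric (s : nat -> nat) (m m' : {cmonom nat}) :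
    bijective s -> (forall k, m' k = m (s k)) ->
  chromatic_qsym (inc P) m' = chromatic_qsym (inc P) m.
Proof.
move=> bij_s m'E; have [N1 m0] := cmonom_bounded m.
have [N2 m'0] := cmonom_bounded m'; pose N := maxn N1 N2.
have m0N k : (N <= k)%N -> m k = 0%N by rewrite geq_max => /andP[/m0].
have m'0N k : (N <= k)%N -> m' k = 0%N by rewrite geq_max => /andP[_ /m'0].
rewrite !chromatic_qsymE -(eq_chromatic_content _ (nth_mkseq_bounded m0N)).
rewrite -(eq_chromatic_content _ (nth_mkseq_bounded m'0N)).
exact/chromatic_content_perm/(perm_mkseq_bij bij_s m'E).
Qed.

(** Reversing the colors reverses the list of exponents; by symmetry the reversed list has the same
    series coefficient, so the identity concerns a single monomial. *)
Lemma coef_chromatic_qsym_sym (m : {cmonom nat}) j : (j <= #|edges (inc P)|)%N ->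
  (chromatic_qsym (inc P) m)`_j
    = (chromatic_qsym (inc P) m)`_(#|edges (inc P)| - j).
Proof.
move=> le_j; have [N m0] := cmonom_bounded m; rewrite !chromatic_qsymE.
rewrite -(eq_chromatic_content _ (nth_mkseq_bounded m0)) -coef_chromatic_content_rev //.
by rewrite (@chromatic_content_perm (rev _) (mkseq m N)) // perm_rev.
Qed.

End Symmetry.

Theorem theorem4p5 (n : nat) (P : poset n) :
  natural_unit_interval_order P -> palindromic (chromatic_qsym (inc P)).
Proof.
move=> P_nuio; pose G := inc P.
exists #|edges G|, (fun j m => (chromatic_qsym G m)`_j); split.
- move=> m; apply/polyP => j; rewrite coef_poly; case: ltnP => // lt_j.
  rewrite chromatic_qsymE coef_chromatic_content big1 // => c _.
  by rewrite gtn_eqF // (leq_ltn_trans (asc_le_edges G c)).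
- move=> j _; split; last first.
    by move=> s m m' bij_s m'E; rewrite (chromatic_qsym_symmetric P_nuio bij_s m'E).
  (* A monomial that occurs comes from a coloring and has degree [n], one factor per vertex. *)
  exists n => m; rewrite chromatic_qsymE coef_chromatic_content => nz.
  have [c [_ cm]] : exists c, colorings_with_content G m c.
    have [//|no_c] := pselect (exists c, colorings_with_content G m c).
    move: nz; rewrite big1_seq ?eqxx // => c /=.
    rewrite in_fset_set ?inE; last exact: finite_colorings.
    by move=> cm; case: no_c; exists c.
  have <- : color_monomial c = m by apply/eqP/cmP => k; rewrite color_monomialE cm.
  rewrite mdeg_prod (eq_bigr (fun=> 1%N)) => [|i _]; last exact: mdegU.
  by rewrite sum1_card card_ord.
- pose c := [ffun i : 'I_n => val i]; exists (color_monomial c).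
  rewrite chromatic_qsymE coef_chromatic_content gt_eqF //.
  have c_in : c \in fset_set (colorings_with_content G (color_monomial c)).
    rewrite in_fset_set ?inE; last exact: finite_colorings.
    split=> [i j Gij|k]; last by rewrite color_monomialE.
    by rewrite !ffunE val_eqE; apply: contraTneq Gij => ->; rewrite adj_irr.
  (* All summands are nonnegative, so the one of [c] already makes the top coefficient positive. *)
  rewrite (big_fsetD1 c) //=; apply: ltr_pwDl; last first.
    by apply: sumr_ge0 => ? _; apply: ler0n.
  suff -> : asc G c = #|edges G| by rewrite eqxx.
  by apply: eq_card => p; rewrite !inE !ffunE; case: (G _ _) => //=; rewrite andbb.
- by move=> j le_j m; apply: coef_chromatic_qsym_sym.
Qed.
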